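(* Let $\mathcal{B}$ be the set of all graphs obtained, for some integer $n\ge 4$, from the complete graph $K_n$ with vertices $v_1,\dots,v_n$ and two additional vertices $v_{n+1},v_{n+2}$ such that $v_{n+1}$ and $v_{n+2}$ are adjacent to $v_n$, and $v_{n+1}$ is adjacent to $v_{n-1}$ (with no other additional edges). If $G\in\mathcal{B}$, then $G$ has no $ic$-partition.
   Context: Graphs are finite and simple. A set $S$ of vertices is dominating if every vertex is in $S$ or adjacent to a vertex of $S$; it is independent if its vertices are pairwise nonadjacent; an independent dominating set is a set that is both independent and dominating. An independent coalition in $G$ consists of two disjoint independent sets of vertices $V_1,V_2$, neither of which is an independent dominating set but whose union $V_1\cup V_2$ is an independent dominating set; one says that $V_1$ and $V_2$ form an independent coalition. An $ic$-partition of $G$ is a partition $\pi=\{V_1,\dots,V_k\}$ of $V(G)$ into nonempty sets such that every $V_i\in\pi$ either is a singleton dominating set (a dominating set of cardinality 1), or is not an independent dominating set but forms an independent coalition with another set $V_j\in\pi$. *)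

(* Defs.v *)
From mathcomp Require Import all_boot.

Set Implicit Arguments.
Unset Strict Implicit.
Unset Printing Implicit Defensive.

Record sgraph := SGraph {
  vertex :> finType;
  adj : rel vertex;
  adj_sym : symmetric adj;
  adj_irr : irreflexive adj }.

Definition isomorphic (G H : sgraph) : Prop :=
  exists2 f : G -> H, bijective f & forall x y, adj (f x) (f y) = adj x y.

Section Coalitions.
Variable G : sgraph.
Implicit Types (S A B : {set G}) (pi : {set {set G}}).

Definition dominating S : bool :=
  [forall x, (x \in S) || [exists y in S, adj x y]].

Definition independent S : bool :=
  [forall x in S, forall y in S, ~~ adj x y].

Definition ind_dominating S : bool := independent S && dominating S.

Definition ind_coalition A B : bool :=
  [&& [disjoint A & B], independent A, independent B,
      ~~ ind_dominating A, ~~ ind_dominating B &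
      ind_dominating (A :|: B)].

Definition ic_partition pi : bool :=
  partition pi [set: G] &&
  [forall A in pi,
     ((#|A| == 1) && dominating A)
     || (~~ ind_dominating A
         && [exists B in pi, (B != A) && ind_coalition A B])].

End Coalitions.

(* [i : 'I_n.+2] stands for the vertex v_(i+1); [B_arc n a b] lists the edges
   v_a v_b with a < b, using the 1-based labels. *)
Definition B_arc (n a b : nat) : bool :=
  (a < b) && [|| b <= n,
                 (b == n.+1) && ((a == n) || (a == n.-1)) |
                 (b == n.+2) && (a == n)].

Definition B_adj (n : nat) : rel 'I_n.+2 :=
  fun i j => B_arc n i.+1 j.+1 || B_arc n j.+1 i.+1.

Lemma B_adj_sym n : symmetric (@B_adj n).
Proof. by move=> i j; rewrite /B_adj orbC. Qed.

Lemma B_adj_irr n : irreflexive (@B_adj n).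
Proof. by move=> i; rewrite /B_adj /B_arc ltnn. Qed.

Definition B_graph (n : nat) : sgraph := SGraph (@B_adj_sym n) (@B_adj_irr n).

(* Membership in the family is up to isomorphism. *)
Definition in_B (G : sgraph) : Prop :=
  exists2 n : nat, 4 <= n & isomorphic (B_graph n) G.

(* Main.v *)
Require Import Defs.
From mathcomp Require Import all_boot.
From mathcomp Require Import zify.

(** Write [u] for [v_n], [w] for [v_(n-1)], [a] for [v_(n+1)] and [b] for
    [v_(n+2)], and let [p], [q] be two further vertices of the clique (these
    exist because [4 <= n]).  The pendant vertex [b] is dominated only by
    itself and by [u], and no independent set contains [u] together with
    another vertex.  Hence the coalition that the class of a vertex other than
    [u] and [b] must form has [b] in its union ([coalition_contains_pendant]).

    For the class of [w] this is very restrictive: [{w, b}] is already an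
    independent dominating set, so [b] lies in the partner class, and as [w] is
    adjacent to everything else, that partner is exactly [{b}]
    ([singleton_pendant_class]).  So the class of [p], like that of [q], can only be
    in coalition with [{b}], and has to dominate [a] on its own.  The
    neighbours of [a] are [u] and [w], both adjacent to [p] and [q], so [a]
    lies in the class of [p] and in that of [q].  These classes coincide, and
    contain the edge [pq]: a contradiction ([no_ic_partition_of_shape]). *)

Set Implicit Arguments.
Unset Strict Implicit.
Unset Printing Implicit Defensive.

Lemma independentP (G : sgraph) (S : {set G}) :
  reflect {in S &, forall x y, ~~ adj x y} (independent S).
Proof.
apply: (iffP forall_inP) => [indS x y xS yS | indS x xS].
  exact: (forall_inP (indS x xS)).
by apply/forall_inP => y; apply: indS.
Qed.

Lemma dominatingP (G : sgraph) (S : {set G}) :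
  reflect (forall x, x \in S \/ exists2 y, y \in S & adj x y) (dominating S).
Proof.
apply: (iffP forallP) => domS x.
  by case/orP: (domS x) => [|/exists_inP]; [left | right].
by apply/orP; case: (domS x) => [|?]; [left | right; apply/exists_inP].
Qed.

(** The class of [x] is not a dominating singleton, since [x] does not dominate
    [b]; so it has a partner.  The union contains [x], hence not the universal
    vertex [u], and then only [b] itself is left to dominate [b]. *)
Lemma coalition_contains_pendant (G : sgraph) (pi : {set {set G}})
    (u b x : G) (A : {set G}) :
    ic_partition pi ->
    (forall y, y != u -> adj u y) -> (forall y, adj b y -> y = u) ->
    A \in pi -> x \in A -> x != u -> x != b ->
  exists B, [/\ B \in pi, ind_coalition A B, b \in A :|: B & u \notin A :|: B].
Proof.
case/andP=> _ /forall_inP icA univ_u pend_b Api xA xu xb.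
case/orP: (icA A Api) => [/andP[/cards1P[z defA] /dominatingP domA] |].
  move: xA domA; rewrite {A Api}defA inE => /eqP <- /(_ b).
  case=> [|[y]]; first by rewrite inE eq_sym (negPf xb).
  by rewrite inE => /eqP-> /pend_b xEu; rewrite xEu eqxx in xu.
case/andP=> _ /exists_inP[B Bpi /andP[_ coalAB]]; exists B.
have /and5P[_ _ _ _ /andP[_ /andP[/independentP indU /dominatingP domU]]] :=
  coalAB.
have uNU: u \notin A :|: B.
  apply/negP => uU; have xU: x \in A :|: B by rewrite inE xA.
  by have := indU u x uU xU; rewrite univ_u.
split=> //; case: (domU b) => // -[y yU /pend_b yu].
by rewrite yu (negPf uNU) in yU.
Qed.

(** The class of [w] cannot contain [b], because [{w, b}] is already dominating;
    so its partner does, and the partner contains nothing else, since any other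
    vertex is adjacent to [w]. *)
Lemma singleton_pendant_class (G : sgraph) (pi : {set {set G}}) (u w b : G) :
    ic_partition pi ->
    (forall y, y != u -> adj u y) -> (forall y, adj b y -> y = u) ->
    (forall y, y != w -> y != b -> adj w y) -> w != u -> w != b ->
  [set b] \in pi.
Proof.
move=> ic_pi univ_u pend_b w_adj wu wb.
have /andP[/and3P[/eqP cover_pi _ _] _] := ic_pi.
have /bigcupP[C Cpi wC] : w \in cover pi by rewrite cover_pi inE.
have [D [Dpi coalCD bU _]] :=
  coalition_contains_pendant ic_pi univ_u pend_b Cpi wC wu wb.
have /and5P[disjCD indC _ nidC /andP[_ /andP[/independentP indU _]]] := coalCD.
have bD : b \in D.
  case/setUP: bU => // bC; case/negP: nidC; rewrite /ind_dominating indC /=.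
  apply/dominatingP => x.
  have [->|xb] := eqVneq x b; first by left.
  have [->|xw] := eqVneq x w; first by left.
  by right; exists w; rewrite // adj_sym w_adj.
suff <- : D = [set b] by [].
apply/setP => x; rewrite inE.
have [->|xb] := eqVneq x b; first by [].
apply/negbTE/negP => xD.
have xw : x != w.
  by apply: contraTneq xD => ->; rewrite (disjointFr disjCD wC).
have := indU w x; rewrite !inE wC xD orbT w_adj //.
by move/(_ isT isT).
Qed.

(** Only these adjacencies matter, which frees the argument from the labelling
    of the vertices. *)
Lemma no_ic_partition_of_shape (G : sgraph) (pi : {set {set G}})
    (u w a b p q : G) :
    (forall y, y != u -> adj u y) ->
    (forall y, y != w -> y != b -> adj w y) ->
    (forall y, adj a y -> y = u \/ y = w) ->
    (forall y, adj b y -> y = u) ->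
    w != u -> w != b -> a != b -> adj p q ->
    p \notin [:: u; w; b] -> q \notin [:: u; w; b] ->
  ~~ ic_partition pi.
Proof.
move=> univ_u w_adj a_adj pend_b wu wb ab pq pN qN; apply/negP => ic_pi.
have /andP[/and3P[/eqP cover_pi triv_pi _] _] := ic_pi.
have bpi := singleton_pendant_class ic_pi univ_u pend_b w_adj wu wb.
have class_b X : X \in pi -> b \in X -> X = [set b].
  move=> Xpi bX; rewrite -(def_pblock triv_pi Xpi bX).
  by apply: def_pblock => //; rewrite inE.
have class_a x : x \notin [:: u; w; b] ->
    exists E, [/\ E \in pi, x \in E, a \in E & independent E].
  rewrite !inE !negb_or => /and3P[xu xw xb].
  have /bigcupP[E Epi xE] : x \in cover pi by rewrite cover_pi inE.
  have [F [Fpi coalEF bU uNU]] :=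
    coalition_contains_pendant ic_pi univ_u pend_b Epi xE xu xb.
  have /and5P[_ indE _ _ /andP[_ /andP[/independentP indU /dominatingP domU]]]
    := coalEF.
  exists E; split=> //.
  have FE : F = [set b].
    case/setUP: bU => [bE | /(class_b F Fpi)//].
    by move: xE; rewrite (class_b E Epi bE) inE (negPf xb).
  case: (domU a) => [|[y yU /a_adj[] yE]].
  - by rewrite FE !inE (negPf ab) orbF.
  - by rewrite yE (negPf uNU) in yU.
  - rewrite yE in yU; have := indU w x yU.
    by rewrite inE xE w_adj // => /(_ isT).
have [E [Epi pE aE /independentP indE]] := class_a p pN.
have [F [Fpi qF aF _]] := class_a q qN.
have EF : E = F.
  by rewrite -(def_pblock triv_pi Epi aE) (def_pblock triv_pi Fpi aF).
by rewrite -EF in qF; have := indE p q pE qF; rewrite pq.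
Qed.

Theorem proposition2p2 (G : sgraph) (hG : in_B G) :
  ~ exists pi : {set {set G}}, ic_partition pi.
Proof.
case: hG => n n4 [f [g fK gK] adj_f] [pi]; apply/negP.
have f_inj := can_inj fK.
(* Vertex [v_(i+1)] is the ordinal of value [i]. *)
pose v k : B_graph n := inord k : 'I_n.+2.
have val_v k : k < n.+2 -> nat_of_ord (v k) = k by move/inordK.
have vu : nat_of_ord (v n.-1) = n.-1 by apply: val_v; lia.
have vw : nat_of_ord (v n.-2) = n.-2 by apply: val_v; lia.
have va : nat_of_ord (v n) = n by apply: val_v; lia.
have vb : nat_of_ord (v n.+1) = n.+1 by apply: val_v; lia.
have vp : nat_of_ord (v 0) = 0 by apply: val_v; lia.
have vq : nat_of_ord (v 1) = 1 by apply: val_v; lia.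
apply: (@no_ic_partition_of_shape G pi
  (f (v n.-1)) (f (v n.-2)) (f (v n)) (f (v n.+1)) (f (v 0)) (f (v 1))).
- move=> y; rewrite -(gK y) adj_f (inj_eq f_inj) -val_eqE /= /B_adj /B_arc vu.
  by have := ltn_ord (g y); lia.
- move=> y; rewrite -(gK y) adj_f !(inj_eq f_inj) -!val_eqE /= /B_adj /B_arc.
  by rewrite vw vb; have := ltn_ord (g y); lia.
- move=> y; rewrite -(gK y) adj_f /= /B_adj /B_arc va => adj_ay.
  suff [e|e] : nat_of_ord (g y) = n.-1 \/ nat_of_ord (g y) = n.-2.
  + by left; congr f; apply: val_inj; rewrite /= vu.
  + by right; congr f; apply: val_inj; rewrite /= vw.
  by have := ltn_ord (g y); lia.
- move=> y; rewrite -(gK y) adj_f /= /B_adj /B_arc vb => adj_by.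
  congr f; apply: val_inj; rewrite /= vu.
  by have := ltn_ord (g y); lia.
- by rewrite (inj_eq f_inj) -val_eqE /= vw vu; lia.
- by rewrite (inj_eq f_inj) -val_eqE /= vw vb; lia.
- by rewrite (inj_eq f_inj) -val_eqE /= va vb; lia.
- by rewrite adj_f /= /B_adj /B_arc vp vq; lia.
- by rewrite !inE !(inj_eq f_inj) -!val_eqE /= vp vu vw vb; lia.
- by rewrite !inE !(inj_eq f_inj) -!val_eqE /= vq vu vw vb; lia.
Qed.
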